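(* Let $(E,\mathcal{T})$ be a real $L^0$-pre-barreled module such that $E$ has the countable concatenation property. Then every proper lower semicontinuous $L^0$-convex function $f:E\to\bar L^0(\mathcal{F})$ is continuous on $\mathrm{Int}(\mathrm{dom}(f))$, the interior of $\mathrm{dom}(f)$; namely $f$ is continuous from $(\mathrm{Int}(\mathrm{dom}(f)),\mathcal{T})$ to $(L^0(\mathcal{F}),\mathcal{T}_c)$.
   Context: Notation. $(\Omega,\mathcal{F},P)$ is a probability space; $L^0(\mathcal{F})$ is the algebra of a.s.-equivalence classes of real-valued $\mathcal{F}$-measurable random variables; $\bar L^0(\mathcal{F})$ the set of classes of extended real-valued ones, ordered a.s.; $L^0_+(\mathcal{F})=\{\xi\in L^0(\mathcal{F}):\xi\ge0\}$, $L^0_{++}(\mathcal{F})=\{\xi\in L^0(\mathcal{F}):\xi>0\text{ a.s.}\}$; $\tilde I_A$ is the class of the indicator of $A\in\mathcal{F}$. ''On $\Omega$'' means a.s. $\mathcal{T}_c$ on $L^0(\mathcal{F})$ is the topology with neighborhood base at $\xi$ given by $\{\eta:|\eta-\xi|\le\varepsilon\}$, $\varepsilon\in L^0_{++}(\mathcal{F})$; $(L^0(\mathcal{F}),\mathcal{T}_c)$ is a topological ring. Modules. Every $L^0(\mathcal{F})$-module $E$ considered is assumed to satisfy: if $x,y\in E$ and $\tilde I_{A_n}x=\tilde I_{A_n}y$ for all $n$ for some countable partition $\{A_n\}$ of $\Omega$ into members of $\mathcal{F}$, then $x=y$. A subset $G\subset E$ (possibly $G=E$) has the countable concatenation property if for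 every sequence $\{x_n\}$ in $G$ and every countable partition $\{A_n\}$ of $\Omega$ into members of $\mathcal{F}$ there is $x\in G$ with $\tilde I_{A_n}x=\tilde I_{A_n}x_n$ for all $n$. $B\subset E$ is $L^0$-balanced if $\eta B\subset B$ whenever $\eta\in L^0(\mathcal{F})$, $|\eta|\le1$; $L^0$-convex if $\xi x+(1-\xi)y\in B$ for $x,y\in B$, $\xi\in L^0_+(\mathcal{F})$, $0\le\xi\le1$; $L^0$-absorbent if for each $x\in E$ there is $\xi\in L^0_{++}(\mathcal{F})$ with $\eta x\in B$ for all $\eta\in L^0(\mathcal{F})$, $|\eta|\le\xi$. A (real) locally $L^0$-convex module $(E,\mathcal{T})$ is an $L^0(\mathcal{F})$-module with a topology making it a topological module over $(L^0(\mathcal{F}),\mathcal{T}_c)$ (addition and module multiplication jointly continuous) and having a local base at $\theta$ (the null element) of $L^0$-balanced, $L^0$-absorbent, $L^0$-convex sets. An $L^0$-barrel is an $L^0$-balanced, $L^0$-absorbent, $L^0$-convex, closed set. A real $L^0$-pre-barreled module is a real locally $L^0$-convex module in which every $L^0$-barrel with the countable concatenation property is a neighborhood of $\theta$. Functions. For $f:E\to\bar L^0(\mathcal{F})$, $\mathrm{dom}(f)=\{x\in E:f(x)<+\infty\text{ on }\Omega\}$. $f$ is proper if $\mathrm{dom}(f)\ne\emptyset$ and $f(x)>-\infty$ on $\Omega$ for all $x\in E$. $f$ is $L^0$-convex if $f(\xi x+(1-\xi)y)\le\xi f(x)+(1-\xi)f(y)$ for all $x,y\in E$ and $\xi\in L^0_+(\mathcal{F})$,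 $0\le\xi\le1$, with $0\cdot(\pm\infty)=0$ and $+\infty\pm(\pm\infty)=+\infty$. $f$ is lower semicontinuous if $\{x\in E:f(x)\le r\}$ is $\mathcal{T}$-closed for every $r\in L^0(\mathcal{F})$. *)

(* Defs.v *)
From HB Require Import structures.
From mathcomp Require Import all_boot all_order all_algebra generic_quotient.
From mathcomp Require Import all_classical all_reals all_analysis.
From mathcomp Require Import measurable_realfun.

Set Implicit Arguments.
Unset Strict Implicit.
Unset Printing Implicit Defensive.

Import Order.TTheory GRing.Theory Num.Theory.
Import numFieldNormedType.Exports.

Local Open Scope classical_set_scope.
Local Open Scope ring_scope.

Section ae_class.
Context d d' (T : measurableType d) (U : measurableType d') (R : realType).
Variable mu : {measure set T -> \bar R}.

Definition mfun_of (f : T -> U) (mf : measurable_fun setT f) : {mfun T >-> U} :=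
  HB.pack f (isMeasurableFun.Build _ _ T U f mf).

Definition ae_class (f : {mfun T >-> U}) : {mfun_ mu, T >-> U} :=
  (\pi_({mfun_ mu, T >-> U}) f)%qT.

Definition ae_repr (x : {mfun_ mu, T >-> U}) : {mfun T >-> U} := repr x.

Lemma ae_classE f : \forall w \ae mu, ae_repr (ae_class f) w = f w.
Proof.
have /eqP : (repr (ae_class f) == f %[mod {mfun_ mu, T >-> U}])%qT.
  by rewrite reprK.
by move=> /eqmodP /asboolP; apply: filterS => w; apply.
Qed.

Lemma ae_class_eq (x y : {mfun_ mu, T >-> U}) :
  (\forall w \ae mu, ae_repr x w = ae_repr y w) -> x = y.
Proof.
move=> xy; rewrite -[x]reprK -[y]reprK; apply/eqmodP/asboolP.
by apply: filterS xy.
Qed.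

End ae_class.

Section L0.
Context d (T : measurableType d) (R : realType) (P : probability T R).

Definition L0 : Type := {mfun_ P, T >-> R}.
Definition L0_repr (xi : L0) : {mfun T >-> R} := ae_repr xi.
Coercion L0_repr : L0 >-> MeasurableFun.type.

HB.instance Definition _ := Choice.on L0.

Implicit Types xi eta eps : L0.

Definition L0_class (f : {mfun T >-> R}) : L0 := ae_class P f.

Lemma L0_classE f : \forall w \ae P, L0_class f w = f w.
Proof. exact: ae_classE. Qed.

Lemma L0_eq xi eta : (\forall w \ae P, xi w = eta w) -> xi = eta.
Proof. exact: ae_class_eq. Qed.

Definition L0_zero : L0 := L0_class 0.
Definition L0_one : L0 := L0_class 1.
Definition L0_opp xi : L0 := L0_class (- L0_repr xi).
Definition L0_add xi eta : L0 :=
  L0_class (L0_repr xi + L0_repr eta).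
Definition L0_mul xi eta : L0 :=
  L0_class (L0_repr xi * L0_repr eta).

Lemma L0_zeroE : \forall w \ae P, L0_zero w = 0.
Proof. by apply: filterS (L0_classE 0) => w ->. Qed.
Lemma L0_oneE : \forall w \ae P, L0_one w = 1.
Proof. by apply: filterS (L0_classE 1) => w ->. Qed.
Lemma L0_oppE xi : \forall w \ae P, L0_opp xi w = - xi w.
Proof. exact: L0_classE. Qed.
Lemma L0_addE xi eta : \forall w \ae P, L0_add xi eta w = xi w + eta w.
Proof. exact: L0_classE. Qed.
Lemma L0_mulE xi eta : \forall w \ae P, L0_mul xi eta w = xi w * eta w.
Proof. exact: L0_classE. Qed.

Lemma L0_addA : associative L0_add.
Proof.
move=> a b c; apply: L0_eq; near=> w.
rewrite (near (L0_addE a _)) // (near (L0_addE b c)) //.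
by rewrite (near (L0_addE _ c)) // (near (L0_addE a b)) // addrA.
Unshelve. all: by end_near. Qed.

Lemma L0_addC : commutative L0_add.
Proof.
move=> a b; apply: L0_eq; near=> w.
by rewrite (near (L0_addE a b)) // (near (L0_addE b a)) // addrC.
Unshelve. all: by end_near. Qed.

Lemma L0_add0 : left_id L0_zero L0_add.
Proof.
move=> a; apply: L0_eq; near=> w.
by rewrite (near (L0_addE _ a)) // (near L0_zeroE) // add0r.
Unshelve. all: by end_near. Qed.

Lemma L0_addN : left_inverse L0_zero L0_opp L0_add.
Proof.
move=> a; apply: L0_eq; near=> w.
rewrite (near (L0_addE _ a)) // (near (L0_oppE a)) //.
by rewrite (near L0_zeroE) // addNr.
Unshelve. all: by end_near. Qed.

HB.instance Definition _ :=
  GRing.isZmodule.Build L0 L0_addA L0_addC L0_add0 L0_addN.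

Lemma L0_mulA : associative L0_mul.
Proof.
move=> a b c; apply: L0_eq; near=> w.
rewrite (near (L0_mulE a _)) // (near (L0_mulE b c)) //.
by rewrite (near (L0_mulE _ c)) // (near (L0_mulE a b)) // mulrA.
Unshelve. all: by end_near. Qed.

Lemma L0_mulC : commutative L0_mul.
Proof.
move=> a b; apply: L0_eq; near=> w.
by rewrite (near (L0_mulE a b)) // (near (L0_mulE b a)) // mulrC.
Unshelve. all: by end_near. Qed.

Lemma L0_mul1 : left_id L0_one L0_mul.
Proof.
move=> a; apply: L0_eq; near=> w.
by rewrite (near (L0_mulE _ a)) // (near L0_oneE) // mul1r.
Unshelve. all: by end_near. Qed.

Lemma L0_mulDl : left_distributive L0_mul L0_add.
Proof.
move=> a b c; apply: L0_eq; near=> w.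
rewrite (near (L0_mulE _ c)) // (near (L0_addE a b)) //.
rewrite (near (L0_addE _ _)) // (near (L0_mulE a c)) //.
by rewrite (near (L0_mulE b c)) // mulrDl.
Unshelve. all: by end_near. Qed.

Lemma L0_one_neq0 : L0_one != L0_zero.
Proof.
apply/eqP => e10.
have [w] : exists w, L0_one w = 1 /\ L0_zero w = 0.
  apply: (@filter_ex _ (almost_everywhere P)).
    apply: ae_properfilter_algebraOfSetsType.
    by rewrite [ltRHS]probability_setT.
  exact: filterI L0_oneE L0_zeroE.
by rewrite e10 => -[-> /eqP]; rewrite oner_eq0.
Qed.

HB.instance Definition _ := GRing.Zmodule_isComNzRing.Build L0
  L0_mulA L0_mulC L0_mul1 L0_mulDl L0_one_neq0.

Definition L0_le xi eta : bool := `[< \forall w \ae P, xi w <= eta w >].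

Lemma L0_le_refl : reflexive L0_le.
Proof. by move=> xi; apply/asboolP/aeW. Qed.

Lemma L0_le_anti : antisymmetric L0_le.
Proof.
move=> xi eta /andP[/asboolP le1 /asboolP le2]; apply: L0_eq.
by apply: filterS2 le1 le2 => w ? ?; apply/eqP; rewrite eq_le; apply/andP.
Qed.

Lemma L0_le_trans : transitive L0_le.
Proof.
move=> eta xi zeta /asboolP le1 /asboolP le2; apply/asboolP.
by apply: filterS2 le1 le2 => w; exact: le_trans.
Qed.

HB.instance Definition _ := Order.Le_isPOrder.Build ring_display L0
  L0_le_refl L0_le_anti L0_le_trans.

Lemma L0_leP xi eta : reflect (\forall w \ae P, xi w <= eta w) (xi <= eta).
Proof. exact: asboolP. Qed.

(* This is not [0 < xi]: the strict order attached to [<=] only says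
   [0 <= xi] and [xi != 0]. *)
Definition L0_pos xi : Prop := \forall w \ae P, 0 < xi w.

Definition L0_norm xi : L0 := L0_class (@Num.norm R R \o xi).

Lemma L0_normE xi : \forall w \ae P, L0_norm xi w = `|xi w|.
Proof. exact: L0_classE. Qed.

Definition L0_indic (A : set T) (mA : measurable A) : L0 :=
  L0_class (indic_mfun A mA).

Lemma L0_indicE (A : set T) (mA : measurable A) :
  \forall w \ae P, L0_indic mA w = \1_A w.
Proof. exact: L0_classE. Qed.

Definition L0_ball xi eps : set L0 := [set eta | L0_norm (eta - xi) <= eps].

Lemma L0_ballP xi eps eta : L0_ball xi eps eta <->
  \forall w \ae P, `|eta w - xi w| <= eps w.
Proof.
have E : \forall w \ae P, L0_norm (eta - xi) w = `|eta w - xi w|.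
  near=> w; rewrite (near (L0_normE _)) // (near (L0_addE eta (- xi))) //.
  by rewrite (near (L0_oppE xi)).
split=> [/L0_leP|] H; first by apply: filterS2 E H => w ->.
by apply/L0_leP; apply: filterS2 E H => w ->.
Unshelve. all: by end_near. Qed.

HB.instance Definition _ :=
  hasNbhs.Build L0 (fun xi => filter_from L0_pos (L0_ball xi)).

Lemma L0_nbhsE xi : nbhs xi = filter_from L0_pos (L0_ball xi).
Proof. by []. Qed.

Lemma L0_nbhs_filter xi : ProperFilter (nbhs xi).
Proof.
rewrite L0_nbhsE; apply: filter_from_proper; last first.
  move=> eps eps0; exists xi; apply/L0_ballP.
  by apply: filterS eps0 => w; rewrite subrr normr0 => /ltW.
apply: filter_from_filter.
  by exists 1; apply: filterS L0_oneE => w ->.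
move=> e1 e2 e10 e20; pose e := L0_class (min_mfun e1 e2).
have eE : \forall w \ae P, e w = Num.min (e1 w) (e2 w) by exact: L0_classE.
exists e.
  by apply: filterS3 eE e10 e20 => w -> ? ?; rewrite lt_min; apply/andP.
move=> eta /L0_ballP H; split; apply/L0_ballP; apply: filterS2 eE H => w ->;
  by rewrite le_min => /andP[].
Qed.

Lemma L0_nbhs_singleton xi (A : set L0) : nbhs xi A -> A xi.
Proof.
move=> [eps eps0]; apply; apply/L0_ballP.
by apply: filterS eps0 => w; rewrite subrr normr0 => /ltW.
Qed.

Lemma L0_nbhs_nbhs xi (A : set L0) : nbhs xi A -> nbhs xi (nbhs^~ A).
Proof.
move=> [eps eps0 epsA]; pose e := L0_class (2^-1 \o* eps).
have eE : \forall w \ae P, e w = eps w * 2^-1 by exact: L0_classE.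
have e0 : L0_pos e.
  by apply: filterS2 eE eps0 => w -> ?; rewrite divr_gt0.
exists e => // eta /L0_ballP H1; exists e => // zeta /L0_ballP H2.
apply/epsA/L0_ballP; apply: filterS3 eE H1 H2 => w -> H1 H2.
rewrite [eps w]splitr (_ : zeta w - xi w = (zeta w - eta w) + (eta w - xi w)).
  by rewrite (le_trans (ler_normD _ _))// lerD.
by rewrite addrA subrK.
Qed.

(* The topology T_c. *)
HB.instance Definition _ := Nbhs_isNbhsTopological.Build L0
  L0_nbhs_filter L0_nbhs_singleton L0_nbhs_nbhs.

Definition eL0 : Type := {mfun_ P, T >-> \bar R}.
Definition eL0_repr (x : eL0) : {mfun T >-> \bar R} := ae_repr x.
Coercion eL0_repr : eL0 >-> MeasurableFun.type.

HB.instance Definition _ := Choice.on eL0.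

Implicit Types x y : eL0.

Definition eL0_class (f : {mfun T >-> \bar R}) : eL0 := ae_class P f.

Lemma eL0_classE f : \forall w \ae P, eL0_class f w = f w.
Proof. exact: ae_classE. Qed.

Lemma eL0_eq x y : (\forall w \ae P, x w = y w) -> x = y.
Proof. exact: ae_class_eq. Qed.

Definition eL0_le x y : bool := `[< \forall w \ae P, (x w <= y w)%E >].

Lemma eL0_le_refl : reflexive eL0_le.
Proof. by move=> x; apply/asboolP/aeW. Qed.

Lemma eL0_le_anti : antisymmetric eL0_le.
Proof.
move=> x y /andP[/asboolP le1 /asboolP le2]; apply: eL0_eq.
by apply: filterS2 le1 le2 => w ? ?; apply/eqP; rewrite eq_le; apply/andP.
Qed.

Lemma eL0_le_trans : transitive eL0_le.
Proof.
move=> y x z /asboolP le1 /asboolP le2; apply/asboolP.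
by apply: filterS2 le1 le2 => w; exact: le_trans.
Qed.

HB.instance Definition _ := Order.Le_isPOrder.Build ring_display eL0
  eL0_le_refl eL0_le_anti eL0_le_trans.

Lemma eL0_leP x y : reflect (\forall w \ae P, (x w <= y w)%E) (x <= y).
Proof. exact: asboolP. Qed.

Lemma measurable_EFin_L0 xi : measurable_fun setT (fun w => (xi w)%:E).
Proof. by apply/measurable_EFinP; exact: measurable_funP. Qed.

Definition L0_EFin xi : eL0 := eL0_class (mfun_of (measurable_EFin_L0 xi)).

Lemma L0_EFinE xi : \forall w \ae P, L0_EFin xi w = (xi w)%:E.
Proof. exact: eL0_classE. Qed.

Lemma measurable_fine_eL0 x : measurable_fun setT (fun w => fine (x w)).
Proof. by apply: (measurableT_comp (fine_measurable _)). Qed.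

Definition eL0_fine x : L0 := L0_class (mfun_of (measurable_fine_eL0 x)).

Lemma eL0_fineE x : \forall w \ae P, eL0_fine x w = fine (x w).
Proof. exact: L0_classE. Qed.

Lemma eL0_fineK x : (\forall w \ae P, x w \is a fin_num) ->
  L0_EFin (eL0_fine x) = x.
Proof.
move=> xfin; apply: eL0_eq; near=> w.
rewrite (near (L0_EFinE _)) // (near (eL0_fineE x)) // fineK //.
by near: w.
Unshelve. all: by end_near. Qed.

(* [mule] has [0 * (+oo) = 0 * (-oo) = 0]. *)
Lemma measurable_eL0_scale xi x :
  measurable_fun setT (fun w => ((xi w)%:E * x w)%E).
Proof. by apply: emeasurable_funM => //; exact: measurable_EFin_L0. Qed.

Definition eL0_scale xi x : eL0 :=
  eL0_class (mfun_of (measurable_eL0_scale xi x)).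

Lemma eL0_scaleE xi x :
  \forall w \ae P, eL0_scale xi x w = ((xi w)%:E * x w)%E.
Proof. exact: eL0_classE. Qed.

(* The addition of [ereal_scope] has [+oo + -oo = -oo]; the convention wanted
   here, [+oo + -oo = +oo], is that of [ereal_dual_scope]. *)
Lemma measurable_eL0_add x y : measurable_fun setT (fun w => (x w + y w)%dE).
Proof.
rewrite (_ : (fun w => _) = (fun w => - (- x w + - y w))%E).
  by apply: measurableT_comp => //; apply: emeasurable_funD;
    exact: measurableT_comp.
by apply/funext => w; rewrite DualAddTheoryNumDomain.dual_addeE.
Qed.

Definition eL0_add x y : eL0 := eL0_class (mfun_of (measurable_eL0_add x y)).

Lemma eL0_addE x y : \forall w \ae P, eL0_add x y w = (x w + y w)%dE.
Proof. exact: eL0_classE. Qed.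

End L0.

Section module.
Context d (T : measurableType d) (R : realType) (P : probability T R).
Variable E : lmodType (L0 P).

Definition L0_local : Prop :=
  forall (A : nat -> set T) (mA : forall n, measurable (A n)) (x y : E),
    trivIset setT A -> \bigcup_n A n = setT ->
    (forall n, L0_indic P (mA n) *: x = L0_indic P (mA n) *: y) -> x = y.

(* A countable partition is a sequence of disjoint events covering the whole
   space; some of them may be empty, so that finite partitions are included. *)
Definition countable_concatenation (G : set E) : Prop :=
  forall (A : nat -> set T) (mA : forall n, measurable (A n)) (x_ : nat -> E),
    trivIset setT A -> \bigcup_n A n = setT -> (forall n, G (x_ n)) ->
    exists2 x, G x & forall n, L0_indic P (mA n) *: x = L0_indic P (mA n) *: x_ n.

Definition L0_balanced (B : set E) : Prop :=
  forall (eta : L0 P) x, L0_norm eta <= 1 -> B x -> B (eta *: x).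

Definition L0_convex (B : set E) : Prop :=
  forall (xi : L0 P) x y, 0 <= xi -> xi <= 1 -> B x -> B y ->
    B (xi *: x + (1 - xi) *: y).

Definition L0_absorbent (B : set E) : Prop :=
  forall x, exists2 xi : L0 P, L0_pos xi &
    forall eta : L0 P, L0_norm eta <= xi -> B (eta *: x).

End module.

(* A module over [L0 P] with a topology given by its open sets. The structures
   of tvs.v do not apply, since their scalars form a [numDomainType]. *)
Record topL0Module d (T : measurableType d) (R : realType)
    (P : probability T R) := TopL0Module {
  topL0_lmod : lmodType (L0 P) ;
  topL0_op : set_system topL0_lmod ;
  topL0_opT : topL0_op setT ;
  topL0_opI : setI_closed topL0_op ;
  topL0_op_bigU : forall (I : Type) (f : I -> set topL0_lmod),
    (forall i, topL0_op (f i)) -> topL0_op (\bigcup_i f i)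
}.

Section topological_module.
Context d (T : measurableType d) (R : realType) (P : probability T R).

Definition topL0_sort (E : topL0Module P) : Type := topL0_lmod E.
Coercion topL0_sort : topL0Module >-> Sortclass.

HB.instance Definition _ (E : topL0Module P) :=
  GRing.Lmodule.on (topL0_sort E).
HB.instance Definition _ (E : topL0Module P) :=
  isOpenTopological.Build (topL0_sort E) (@topL0_opT _ _ _ _ E)
    (@topL0_opI _ _ _ _ E) (@topL0_op_bigU _ _ _ _ E).

Implicit Types E : topL0Module P.

Definition locally_L0_convex E : Prop :=
  [/\ L0_local E,
      continuous (fun z : E * E => z.1 + z.2),
      continuous (fun z : L0 P * E => z.1 *: z.2) &
      exists2 B : set_system E,
        (forall U, B U -> [/\ L0_balanced U, L0_absorbent U & L0_convex U]) &
        nbhs (0 : E) = filter_from B id].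

Definition L0_barrel E (B : set E) : Prop :=
  [/\ L0_balanced B, L0_absorbent B, L0_convex B & closed B].

Definition L0_prebarreled E : Prop :=
  locally_L0_convex E /\
  forall B : set E, L0_barrel B -> countable_concatenation B -> nbhs (0 : E) B.

Variable E : topL0Module P.
Implicit Type f : E -> eL0 P.

Definition L0_dom f : set E := [set x | \forall w \ae P, (f x w < +oo)%E].

Definition L0_proper f : Prop :=
  L0_dom f !=set0 /\ forall x, \forall w \ae P, (-oo < f x w)%E.

Definition L0_convex_fun f : Prop :=
  forall (xi : L0 P) (x y : E), 0 <= xi -> xi <= 1 ->
    f (xi *: x + (1 - xi) *: y) <=
    eL0_add (eL0_scale xi (f x)) (eL0_scale (1 - xi) (f y)).

Definition L0_lower_semicontinuous f : Prop :=
  forall r : L0 P, closed [set x | f x <= L0_EFin r].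

End topological_module.

(* Main.v *)
(** Fix [x0] in the interior of [dom f], put [c = f x0] and let [eps > 0]. The
    set [B] of those [x] with [f (x0 + x) <= c + eps] and
    [f (x0 - x) <= c + eps] is convex, symmetric and closed; it is absorbent
    because convexity along a ray bounds [f (x0 + t x)] by
    [c + t (f (x0 + x) - c)], and it has the countable concatenation property
    because an [L0]-convex function is local: on an event [A], [f x] depends
    only on [I_A x]. So [B] is a barrel, hence a neighborhood of [0]. On
    [x0 + B] the upper bound holds by definition, and the lower bound
    [c - eps <= f (x0 + x)] follows from
    [c <= (f (x0 + x) + f (x0 - x)) / 2]. *)
Require Import Defs.
From mathcomp Require Import all_boot all_order all_algebra.
From mathcomp Require Import all_classical all_reals all_analysis.
From mathcomp Require Import measurable_realfun.
From mathcomp Require Import ring lra.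

Set Implicit Arguments.
Unset Strict Implicit.
Unset Printing Implicit Defensive.

Import Order.TTheory GRing.Theory Num.Theory.
Import numFieldNormedType.Exports.
Import DualAddTheory.

Local Open Scope classical_set_scope.
Local Open Scope ring_scope.

(** * Arithmetic and order of [L0 P], read almost everywhere *)

Section L0_arith.
Context d (T : measurableType d) (R : realType) (P : probability T R).
Implicit Types xi eta : L0 P.

Lemma L0_1rE : \forall w \ae P, (1 : L0 P) w = 1.
Proof. exact: L0_oneE. Qed.

Lemma L0_addrE xi eta : \forall w \ae P, (xi + eta : L0 P) w = xi w + eta w.
Proof. exact: L0_addE. Qed.

Lemma L0_mulrE xi eta : \forall w \ae P, (xi * eta : L0 P) w = xi w * eta w.
Proof. exact: L0_mulE. Qed.

Lemma L0_subrE xi eta : \forall w \ae P, (xi - eta : L0 P) w = xi w - eta w.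
Proof.
by apply: filterS2 (L0_addrE xi (- eta)) (L0_oppE eta) => w -> <-.
Qed.

Lemma L0_ge0P xi : 0 <= xi <-> \forall w \ae P, 0 <= xi w.
Proof.
split=> [/L0_leP|] H; first by apply: filterS2 (@L0_zeroE _ _ _ P) H => w <-.
by apply/L0_leP; apply: filterS2 (@L0_zeroE _ _ _ P) H => w ->.
Qed.

Lemma L0_le1P xi : xi <= 1 <-> \forall w \ae P, xi w <= 1.
Proof.
split=> [/L0_leP|] H; first by apply: filterS2 L0_1rE H => w ->.
by apply/L0_leP; apply: filterS2 L0_1rE H => w ->.
Qed.

Lemma L0_norm_leP xi eta :
  L0_norm xi <= eta <-> \forall w \ae P, `|xi w| <= eta w.
Proof.
split=> [/L0_leP|] H; first by apply: filterS2 (L0_normE xi) H => w ->.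
by apply/L0_leP; apply: filterS2 (L0_normE xi) H => w ->.
Qed.

(** The pointwise inverse, defined almost everywhere since [xi] is a.s. positive, is an inverse in
    the ring of classes. *)
Lemma L0_pos_inv xi : L0_pos xi -> exists2 eta, L0_pos eta & eta * xi = 1.
Proof.
move=> xi0.
(* [powR] with exponent -1 is measurable and equals the inverse at positive reals. *)
have mf : measurable_fun setT (fun w => powR (xi w) (-1)).
  exact: (measurableT_comp (@measurable_powR R (-1)) (measurable_funP xi)).
pose eta : L0 P := L0_class P (mfun_of mf).
have etaE : \forall w \ae P, eta w = (xi w)^-1.
  apply: filterS2 (L0_classE P (mfun_of mf)) xi0 => w -> xiw.
  by rewrite /= powR_inv1 // ltW.
exists eta; first by apply: filterS2 etaE xi0 => w ->; rewrite invr_gt0.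
apply: L0_eq; near=> w.
rewrite (near (L0_mulrE eta xi)) // (near L0_1rE) // (near etaE) //.
by rewrite mulVf // gt_eqF //; near: w.
Unshelve. all: by end_near. Qed.

(** The constant 1/2 in two forms: pointwise for estimates, [h + h = 1] for identities in the
    module. *)
Lemma L0_half : exists2 h : L0 P, (\forall w \ae P, h w = 2^-1) & h + h = 1.
Proof.
pose h : L0 P := L0_class P (mfun_of (measurable_cst (2^-1 : R))).
have hE : \forall w \ae P, h w = 2^-1 by exact: L0_classE.
exists h => //; apply: L0_eq; near=> w.
rewrite (near (L0_addrE h h)) // (near L0_1rE) // (near hE) //.
by rewrite [RHS]splitr mul1r.
Unshelve. all: by end_near. Qed.

End L0_arith.

(** * Criteria for balanced and absorbent sets *)

Section L0_sets.
Context d (T : measurableType d) (R : realType) (P : probability T R).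
Variable E : lmodType (L0 P).
Implicit Types (B : set E) (x y : E).

(* [eta *: x] is the convex combination of [x] and [- x] with weights
   [(1 + eta) / 2] and [(1 - eta) / 2]. *)
Lemma L0_convex_symmetric_balanced B :
  L0_convex B -> (forall x, B x -> B (- x)) -> L0_balanced B.
Proof.
move=> Bcvx Bsym eta x /L0_norm_leP eta1 Bx.
have [h hE hh] := @L0_half _ _ _ P.
pose xi : L0 P := h * (1 + eta).
have xiE : \forall w \ae P, xi w = 2^-1 * (1 + eta w) /\ `|eta w| <= 1.
  near=> w; split; last by rewrite -(near (@L0_1rE _ _ _ P) w) //; near: w.
  rewrite (near (L0_mulrE h (1 + eta))) // (near (L0_addrE 1 eta)) //.
  by rewrite (near (@L0_1rE _ _ _ P)) // (near hE).
have -> : eta *: x = xi *: x + (1 - xi) *: - x.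
  rewrite scalerN -scaleNr -scalerDl; congr (_ *: _).
  have -> : xi + - (1 - xi) = (h + h) * (1 + eta) - 1 by rewrite /xi; ring.
  by rewrite hh; ring.
apply: Bcvx => //; last exact: Bsym.
  apply/L0_ge0P; apply: filterS xiE => w [->]; rewrite ler_norml => /andP[? ?].
  lra.
apply/L0_le1P; apply: filterS xiE => w [->]; rewrite ler_norml => /andP[? ?].
lra.
Unshelve. all: by end_near. Qed.

(** If [|eta| <= xi], then [eta = (eta / xi) * xi] with [|eta / xi| <= 1], so one positive multiple
    of [x] in [B] suffices. *)
Lemma L0_balanced_absorbent B : L0_balanced B ->
  (forall x, exists2 xi : L0 P, L0_pos xi & B (xi *: x)) -> L0_absorbent B.
Proof.
move=> Bbal BxiP x; have [xi xi0 Bxi] := BxiP x; exists xi => // eta.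
move=> /L0_norm_leP etaxi.
have [zeta zeta0 zetaK] := L0_pos_inv xi0.
rewrite -[eta]mulr1 -zetaK mulrA -scalerA; apply: Bbal => //.
apply/L0_norm_leP; near=> w.
have zxi : zeta w * xi w = 1.
  by rewrite -(near (L0_mulrE zeta xi) w) // zetaK (near (@L0_1rE _ _ _ P) w).
have zw : 0 < zeta w by near: w.
rewrite (near (L0_mulrE eta zeta)) // (near (@L0_1rE _ _ _ P)) //.
rewrite normrM (gtr0_norm zw) -zxi mulrC ler_pM2l //; near: w.
exact: etaxi.
Unshelve. all: by end_near. Qed.

End L0_sets.

(** * Continuity of affine maps, in the vector and in the scalar *)

Section affine_continuity.
Context d (T : measurableType d) (R : realType) (P : probability T R).
Variable E : topL0Module P.
Implicit Types (x y : E) (xi : L0 P).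

Lemma continuous_L0_affine x xi :
  locally_L0_convex E -> continuous (fun y => x + xi *: y).
Proof.
move=> [_ addc scalec _] y.
apply: (@continuous2_cvg _ E E E (nbhs y) _ (fun=> x) _ +%R).
- exact: (addc (x, xi *: y)).
- exact: cvg_cst.
apply: (@continuous2_cvg _ (L0 P) E E (nbhs y) _ (fun=> xi) id *:%R).
- exact: (scalec (xi, y)).
- exact: cvg_cst.
- exact: cvg_id.
Qed.

Lemma continuous_L0_line x y :
  locally_L0_convex E -> continuous (fun xi => x + xi *: y).
Proof.
move=> [_ addc scalec _] xi.
apply: (@continuous2_cvg _ E E E (nbhs xi) _ (fun=> x) _ +%R).
- exact: (addc (x, xi *: y)).
- exact: cvg_cst.
apply: (@continuous2_cvg _ (L0 P) E E (nbhs xi) _ id (fun=> y) *:%R).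
- exact: (scalec (xi, y)).
- exact: cvg_id.
- exact: cvg_cst.
Qed.

End affine_continuity.

(** * Sublevel sets, locality and radial bounds of convex functions *)

Section convex_fun.
Context d (T : measurableType d) (R : realType) (P : probability T R).
Variable E : topL0Module P.
Implicit Types (f : E -> eL0 P) (x y : E) (r xi : L0 P).

Lemma L0_convex_funP f xi x y : L0_convex_fun f -> 0 <= xi -> xi <= 1 ->
  \forall w \ae P, (f (xi *: x + (1 - xi) *: y)%R w <=
    ((xi w)%:E * f x w + (1 - xi w)%R%:E * f y w)%dE)%E.
Proof.
move=> fcvx xi0 xi1; have /eL0_leP cvxE := fcvx xi x y xi0 xi1.
near=> w.
have -> : 1 - xi w = (1 - xi : L0 P) w.
  by rewrite (near (L0_subrE 1 xi)) // (near (@L0_1rE _ _ _ P)).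
rewrite -(near (eL0_scaleE xi (f x)) w) //.
rewrite -(near (eL0_scaleE (1 - xi) (f y)) w) //.
rewrite -(near (eL0_addE _ _) w) //; near: w; exact: cvxE.
Unshelve. all: by end_near. Qed.

Lemma L0_convex_fun_affine f x (s : L0 P) :
  L0_convex_fun f -> L0_convex_fun (fun y => f (x + s *: y)).
Proof.
move=> fcvx xi y z xi0 xi1.
have -> : x + s *: (xi *: y + (1 - xi) *: z) =
    xi *: (x + s *: y) + (1 - xi) *: (x + s *: z).
  rewrite !scalerDr !scalerA [s * _]mulrC [s * (1 - _)]mulrC addrACA -scalerDl.
  by rewrite subrKC scale1r.
exact: fcvx.
Qed.

Lemma L0_EFin_le r xi : (L0_EFin r <= L0_EFin xi) = (r <= xi).
Proof.
apply/eL0_leP/L0_leP => H; near=> w.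
  rewrite -lee_fin -(near (L0_EFinE r) w) // -(near (L0_EFinE xi) w) //.
  by near: w.
by rewrite (near (L0_EFinE r)) // (near (L0_EFinE xi)) // lee_fin; near: w.
Unshelve. all: by end_near. Qed.

(** Replacing values that may be infinite by bounds in [L0 P] moves the convexity inequality into
    ring arithmetic. *)
Lemma L0_convex_fun_le f (a b : L0 P) xi x y :
  L0_convex_fun f -> 0 <= xi -> xi <= 1 ->
  f x <= L0_EFin a -> f y <= L0_EFin b ->
  f (xi *: x + (1 - xi) *: y) <= L0_EFin (xi * a + (1 - xi) * b).
Proof.
move=> fcvx xi0 xi1 /eL0_leP fx /eL0_leP fy; apply/eL0_leP.
have cvxE := L0_convex_funP x y fcvx xi0 xi1.
move/L0_ge0P : xi0 => xi0; move/L0_le1P : xi1 => xi1.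
near=> w.
have fxw : (f x w <= (a w)%:E)%E by rewrite -(near (L0_EFinE a) w) //; near: w.
have fyw : (f y w <= (b w)%:E)%E by rewrite -(near (L0_EFinE b) w) //; near: w.
have xi0w : 0 <= xi w by near: w.
have xi1w : xi w <= 1 by near: w.
rewrite (near (L0_EFinE _)) // (near (L0_addrE (xi * a) _)) //.
rewrite (near (L0_mulrE xi a)) // (near (L0_mulrE (1 - xi) b)) //.
rewrite (near (L0_subrE 1 xi)) // (near (@L0_1rE _ _ _ P)) //.
apply: (@le_trans _ _ ((xi w)%:E * f x w + (1 - xi w)%R%:E * f y w)%dE).
  by near: w.
by rewrite (dEFinD (xi w * a w)) !EFinM; apply: lee_dD; apply: lee_wpmul2l => //;
  rewrite lee_fin ?subr_ge0.
Unshelve. all: by end_near. Qed.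

Lemma L0_sublevel_convex f r :
  L0_convex_fun f -> L0_convex [set x | f x <= L0_EFin r].
Proof.
move=> fcvx xi x y xi0 xi1 /= fx fy.
have -> : r = xi * r + (1 - xi) * r by ring.
exact: L0_convex_fun_le.
Qed.

(* [x = I_A x + (1 - I_A) x = I_A y + (1 - I_A) x], so that convexity bounds
   [f x] by [f y] on [A]. *)
Lemma L0_convex_fun_local f (A : set T) (mA : measurable A) x y :
  L0_convex_fun f -> L0_indic P mA *: x = L0_indic P mA *: y ->
  \forall w \ae P, A w -> (f x w <= f y w)%E.
Proof.
move=> fcvx xy; set I := L0_indic P mA.
have IE : \forall w \ae P, I w = \1_A w by exact: L0_indicE.
have I0 : 0 <= I.
  by apply/L0_ge0P; apply: filterS IE => w ->; rewrite indicE; case: (_ \in _).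
have I1 : I <= 1.
  by apply/L0_le1P; apply: filterS IE => w ->; rewrite indicE; case: (_ \in _).
have := L0_convex_funP y x fcvx I0 I1.
rewrite -[in I *: y]/I -xy -/I -scalerDl subrKC scale1r => H.
apply: filterS2 IE H => w -> + Aw.
(* On [A] the second term is [0 * f x w], which is 0 even where [f x w] is infinite. *)
by rewrite indicE mem_set // subrr mul1e mul0e dadde0.
Qed.

Lemma L0_sublevel_concat f (A : nat -> set T) (mA : forall n, measurable (A n))
    (x_ : nat -> E) x r :
  L0_convex_fun f -> \bigcup_n A n = setT ->
  (forall n, L0_indic P (mA n) *: x = L0_indic P (mA n) *: x_ n) ->
  (forall n, f (x_ n) <= L0_EFin r) -> f x <= L0_EFin r.
Proof.
move=> fcvx AT xE fx_; apply/eL0_leP.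
(* Countability of the index allows a single null set for all [n]. *)
have loc : \forall w \ae P, forall n, A n w -> (f x w <= f (x_ n) w)%E.
  by apply: ae_foralln => n; exact: L0_convex_fun_local (xE n).
have le : \forall w \ae P, forall n, (f (x_ n) w <= L0_EFin r w)%E.
  by apply: ae_foralln => n; exact/eL0_leP.
apply: filterS2 loc le => w loc le.
have [n _ Anw] : (\bigcup_n A n) w by rewrite AT.
exact: le_trans (loc n Anw) (le n).
Qed.

Lemma L0_fin_numK f x : (\forall w \ae P, (-oo < f x w)%E) -> L0_dom f x ->
  L0_EFin (eL0_fine (f x)) = f x.
Proof.
move=> fNoo foo; apply: eL0_fineK.
by apply: filterS2 fNoo foo => w; rewrite fin_numE -ltNye -ltey => -> ->.
Qed.

Lemma L0_dom_le f x r : f x <= L0_EFin r -> L0_dom f x.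
Proof.
move=> /eL0_leP fxr; apply: filterS2 (L0_EFinE r) fxr => w -> /le_lt_trans.
by apply; exact: ltry.
Qed.

(** Only an inequality: where [f x] is [-oo], [fine] returns 0. *)
Lemma L0_dom_fine_le f x : L0_dom f x -> f x <= L0_EFin (eL0_fine (f x)).
Proof.
move=> foo; apply/eL0_leP; near=> w.
rewrite (near (L0_EFinE _)) // (near (eL0_fineE (f x))) //.
have : (f x w < +oo)%E by near: w.
by case: (f x w) => //; rewrite leNye.
Unshelve. all: by end_near. Qed.

(* The witness is [t = eps / (eps + b)] with [b = `|f1 x - c| + `|f2 x - c|]. *)
Lemma L0_convex_fun_radial f1 f2 (c eps : L0 P) x :
  L0_convex_fun f1 -> L0_convex_fun f2 -> L0_pos eps ->
  f1 0 <= L0_EFin c -> f2 0 <= L0_EFin c -> L0_dom f1 x -> L0_dom f2 x ->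
  exists2 t : L0 P, L0_pos t &
    f1 (t *: x) <= L0_EFin (c + eps) /\ f2 (t *: x) <= L0_EFin (c + eps).
Proof.
move=> f1cvx f2cvx eps0 f10 f20 f1x f2x.
set a1 := eL0_fine (f1 x); set a2 := eL0_fine (f2 x).
pose b : L0 P := L0_norm (a1 - c) + L0_norm (a2 - c).
have bE : \forall w \ae P, b w = `|a1 w - c w| + `|a2 w - c w|.
  near=> w; rewrite (near (L0_addrE (L0_norm (a1 - c)) _)) //.
  rewrite (near (L0_normE (a1 - c))) // (near (L0_normE (a2 - c))) //.
  by rewrite (near (L0_subrE a1 c)) // (near (L0_subrE a2 c)).
have [zeta zeta0 zetaK] : exists2 zeta : L0 P,
    L0_pos zeta & zeta * (eps + b) = 1.
  apply: L0_pos_inv; near=> w.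
  rewrite (near (L0_addrE eps b)) // (near bE) // ltr_wpDr ?addr_ge0 //.
  by near: w.
pose t : L0 P := zeta * eps.
have tE : \forall w \ae P, t w = zeta w * eps w by exact: L0_mulrE.
(* Hence [1 - t = zeta * b], which gives both [t <= 1] and [t * b = (zeta * b) * eps <= eps]. *)
have tbE : \forall w \ae P, t w + zeta w * b w = 1.
  near=> w; rewrite (near tE) // -mulrDr -(near (L0_addrE eps b) w) //.
  by rewrite -(near (L0_mulrE zeta _) w) // zetaK (near (@L0_1rE _ _ _ P)).
have zetab0 : \forall w \ae P, 0 <= zeta w * b w.
  by apply: filterS2 zeta0 bE => w ? ->; rewrite mulr_ge0 ?addr_ge0 // ltW.
have tpos : L0_pos t.
  by apply: filterS3 tE zeta0 eps0 => w -> ? ?; rewrite mulr_gt0.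
have t0 : 0 <= t by apply/L0_ge0P; apply: filterS tpos => w /ltW.
have t1 : t <= 1.
  by apply/L0_le1P; apply: filterS2 tbE zetab0 => w <-; rewrite lerDl.
have bound g : L0_convex_fun g -> g 0 <= L0_EFin c ->
    g x <= L0_EFin (c + b) -> g (t *: x) <= L0_EFin (c + eps).
  move=> gcvx g0 gx.
  have := L0_convex_fun_le gcvx t0 t1 gx g0; rewrite scaler0 addr0.
  move=> /le_trans; apply; rewrite L0_EFin_le.
  have -> : t * (c + b) + (1 - t) * c = c + t * b by ring.
  apply/L0_leP; near=> w.
  rewrite (near (L0_addrE c (t * b))) // (near (L0_addrE c eps)) //.
  rewrite (near (L0_mulrE t b)) // lerD2l (near tE) // mulrAC ler_piMl //.
    by apply: ltW; near: w.
  rewrite -(near tbE w) // lerDr ltW //; near: w; exact: tpos.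
exists t => //; split; apply: bound => //.
  apply: le_trans (L0_dom_fine_le f1x) _; rewrite L0_EFin_le; apply/L0_leP.
  near=> w; rewrite (near (L0_addrE c b)) // (near bE) // -lerBlDl.
  by rewrite ler_wpDr // ler_norm.
apply: le_trans (L0_dom_fine_le f2x) _; rewrite L0_EFin_le; apply/L0_leP.
near=> w; rewrite (near (L0_addrE c b)) // (near bE) // -lerBlDl.
by rewrite ler_wpDl // ler_norm.
Unshelve. all: by end_near. Qed.

(** Continuity of [xi |-> x + xi *: y] at 0 sends a whole ball of some radius [delta] into [A]; that
    ball contains both [delta] and [- delta]. *)
Lemma L0_interior_ray (A : set E) x y : locally_L0_convex E -> A° x ->
  exists2 delta : L0 P, L0_pos delta &
    A (x + 1 *: (delta *: y)) /\ A (x + -1 *: (delta *: y)).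
Proof.
move=> Elc Ax.
have := @continuous_L0_line _ _ _ _ _ x y Elc 0 A.
rewrite scale0r addr0 => /(_ Ax) [delta delta0 deltaA].
exists delta => //; rewrite !scalerA mul1r mulN1r; split; apply: deltaA.
  apply/L0_ballP; near=> w.
  rewrite (near (@L0_zeroE _ _ _ P)) // subr0 ger0_norm // ltW //.
  by near: w.
apply/L0_ballP; near=> w.
rewrite (near (@L0_zeroE _ _ _ P)) // subr0 (near (L0_oppE delta)) // normrN.
by rewrite ger0_norm // ltW //; near: w.
Unshelve. all: by end_near. Qed.

End convex_fun.

(* A proper [f] is a.s. finite at each point of [L0_dom f]; by [eL0_fineK] its
   value there is then the element [eL0_fine (f x)] of [L0 P]. *)
Theorem theorem4p2 (d : measure_display) (T : measurableType d) (R : realType)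
    (P : probability T R) (E : topL0Module P) (f : E -> eL0 P) :
  L0_prebarreled E -> countable_concatenation [set: E] ->
  L0_proper f -> L0_lower_semicontinuous f -> L0_convex_fun f ->
  {within (L0_dom f)°, continuous (fun x => eL0_fine (f x))}.
Proof.
move=> [Elc Ebarrel] Ecc [_ fNoo] flsc fcvx.
apply: continuous_in_subspaceT => x0; rewrite inE => x0int.
set c := eL0_fine (f x0).
have fx0 : f x0 = L0_EFin c.
  by rewrite L0_fin_numK //; exact: interior_subset x0int.
move=> W [eps eps0 epsW].
(* With [s = 1] and [s = -1] this covers both conditions defining the barrel. *)
pose g (s : L0 P) y := f (x0 + s *: y).
have gcvx s : L0_convex_fun (g s) by exact: L0_convex_fun_affine.
have g0 s : g s 0 <= L0_EFin c by rewrite /g scaler0 addr0 fx0.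
pose S (s : L0 P) := [set y | g s y <= L0_EFin (c + eps)].
have Scvx s : L0_convex (S s) by exact: L0_sublevel_convex.
have Bcvx : L0_convex (S 1 `&` S (-1)).
  by move=> xi x y xi0 xi1 [x1 x2] [y1 y2]; split; exact: Scvx.
have Bbal : L0_balanced (S 1 `&` S (-1)).
  apply: L0_convex_symmetric_balanced => // x [].
  by rewrite /S /g /= !scaleN1r !scale1r opprK.
have B0 : nbhs (0 : E) (S 1 `&` S (-1)).
  apply: Ebarrel.
    split => //.
    (* [delta] brings [x] into both domains, then [t] brings the values below [c + eps]. *)
    - apply: L0_balanced_absorbent => // x.
      have [delta delta0 [d1 d2]] := L0_interior_ray x Elc x0int.
      have [t t0 [t1 t2]] := L0_convex_fun_radial (gcvx 1) (gcvx (-1)) eps0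
        (g0 _) (g0 _) d1 d2.
      exists (t * delta); last by rewrite -scalerA; split.
      apply: filterS3 (L0_mulrE t delta) t0 delta0 => w -> ? ?.
      exact: mulr_gt0.
    - apply: closedI; apply: (@preimage_closed E E) (flsc (c + eps)) => x _;
        exact: continuous_L0_affine.
  move=> A mA x_ Atriv AT Bx_.
  (* The hypothesis on [E] supplies the glued point; locality of [f] keeps it in both sublevel
     sets. *)
  have [x _ xE] := Ecc A mA x_ Atriv AT (fun=> I).
  by exists x => //; split; apply: L0_sublevel_concat xE _ => // n;
    have [] := Bx_ n.
have near_x0 : nbhs x0 [set y | (S 1 `&` S (-1)) (y - x0)].
  rewrite (_ : mkset _ = (fun y : E => - x0 + 1 *: y) @^-1` (S 1 `&` S (-1))).
    by apply: (@continuous_L0_affine _ _ _ _ _ _ _ Elc); rewrite scale1r addNr.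
  by apply/funext => y; rewrite /= scale1r addrC.
apply: filterS near_x0 => y [].
rewrite /S /g /= scaleN1r scale1r subrKC opprB => fy fz.
(* [z] is the reflection of [y] in [x0], so that [x0] is the midpoint of [y] and [z]. *)
apply: epsW; apply/L0_ballP; rewrite /= -/c; set z := x0 + (x0 - y) in fz.
have fyE : f y = L0_EFin (eL0_fine (f y)).
  by rewrite L0_fin_numK //; exact: L0_dom_le fy.
set a := eL0_fine (f y) in fyE *.
have [h hE hh] := @L0_half _ _ _ P.
have mid : h *: y + (1 - h) *: z = x0.
  rewrite -hh addrK -scalerDr /z addrCA [y + _]addrC subrK -mulr2n.
  by rewrite -scaler_nat scalerA mulr_natr mulr2n hh scale1r.
have h0 : 0 <= h by apply/L0_ge0P; apply: filterS hE => w ->; lra.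
have h1 : h <= 1 by apply/L0_le1P; apply: filterS hE => w ->; lra.
have fyle : f y <= L0_EFin a by rewrite -fyE.
have := L0_convex_fun_le fcvx h0 h1 fyle fz.
rewrite mid fx0 L0_EFin_le => /L0_leP lower.
move: fy; rewrite fyE L0_EFin_le => /L0_leP upper.
near=> w.
have : a w <= c w + eps w.
  by rewrite -(near (L0_addrE c eps) w) //; near: w.
(* Convexity at the midpoint, with [f z] bounded by [c + eps]; solving for [a] gives
   [c - eps <= a]. *)
have : c w <= 2^-1 * a w + (1 - 2^-1) * (c w + eps w).
  rewrite -(near (L0_addrE c eps) w) // -(near hE w) //.
  rewrite -[X in X - h w](near (@L0_1rE _ _ _ P) w) //.
  rewrite -(near (L0_subrE 1 h) w) // -(near (L0_mulrE h a) w) //.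
  rewrite -(near (L0_mulrE (1 - h) (c + eps)) w) //.
  by rewrite -(near (L0_addrE (h * a) _) w) //; near: w.
by move=> lo up; rewrite ler_norml; apply/andP; split; lra.
Unshelve. all: by end_near. Qed.
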